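(* Let $u_*\in\mathcal H^r$, $r\ge2$, be a nondegenerate equilibrium of $\dot v+Av=F(v)$, and assume the regularity hypothesis on $F$ near $u_*$ stated in the context. Then there are $\varepsilon_0>0$, a neighborhood $U_*\subset\mathcal H^2$ of $u_*$, a constant $C_*$ (independent of $\varepsilon$), and a unique family of equilibria $$u_*^\varepsilon\in U_*,\qquad A_\varepsilon u_*^\varepsilon=F(u_*^\varepsilon),\qquad 0<\varepsilon\le\varepsilon_0,$$ with $$\|u_*^\varepsilon-u_*\|_2\le C_*\,\varepsilon^{r-1}\|u_*\|_r .$$ In particular, every $\mathcal H^2$ nondegenerate equilibrium persists with an $O(\varepsilon)$ error in the graph norm $\|\cdot\|_2$.
   Context: $\mathcal H$ is an infinite-dimensional real Hilbert space and $A:\mathrm D(A)\subset\mathcal H\to\mathcal H$ is a nonnegative self-adjoint operator with compact resolvent. For $r\ge0$, $\mathcal H^r=\mathrm D((I+A)^{r/2})$ with norm $\|u\|_r=\|(I+A)^{r/2}u\|_{\mathcal H}$. Fix $\mu>0$. For $0<\varepsilon\le1$ let $\Lambda_\varepsilon=\mu\varepsilon^{-2}$, $P_\varepsilon=\mathbf 1_{[0,\Lambda_\varepsilon]}(A)$, $Q_\varepsilon=I-P_\varepsilon$, $A_\varepsilon=A+\varepsilon^{-1}Q_\varepsilon$ with $\mathrm D(A_\varepsilon)=\mathrm D(A)=\mathcal H^2$. Regularity hypothesis on the map $F:\mathcal H\to\mathcal H$: on an open bounded neighborhood $\mathcal U\subset\mathcal H^2$ of the equilibrium under consideration, the restriction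 $F|_{\mathcal U}:\mathcal U\to\mathcal H$ is continuously Fréchet differentiable; for each $u\in\mathcal U$ its derivative extends to a bounded operator $DF(u):\mathcal H\to\mathcal H$; and there are constants $C_{\mathcal U},L_{\mathcal U}>0$ with $\sup_{u\in\mathcal U}\|DF(u)\|_{\mathcal L(\mathcal H)}\le C_{\mathcal U}$ and $\|DF(u)-DF(v)\|_{\mathcal L(\mathcal H)}\le L_{\mathcal U}\|u-v\|_2$ for $u,v\in\mathcal U$. An equilibrium $u_*\in\mathcal H^2$ satisfies $Au_*-F(u_* )=0$. It is nondegenerate if $A-DF(u_* ):\mathcal H^2\to\mathcal H$ is an isomorphism. *)

(* Defs.v *)
From HB Require Import structures.
From mathcomp Require Import all_boot all_order all_algebra sesquilinear.
From mathcomp Require Import all_classical all_reals all_analysis.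
From mathcomp Require summability.

Set Implicit Arguments.
Unset Strict Implicit.
Unset Printing Implicit Defensive.
Import Order.TTheory GRing.Theory Num.Theory numFieldNormedType.Exports.
Local Open Scope classical_set_scope.
Local Open Scope ring_scope.

(* A real Hilbert space is a complete normed space [H] over a [realType] with
   an inner product [dot : {dot H for idfun}] (bilinear, symmetric, positive
   definite) inducing the norm. *)
Definition induces_norm (R : realType) (H : completeNormedModType R)
    (dot : {dot H for idfun}) : Prop :=
  forall u : H, dot u u = `|u| ^+ 2.

Definition infinite_dimensional (R : realType) (H : lmodType R) : Prop :=
  forall s : seq H, exists u : H,
    forall c : nat -> R, u <> \sum_(i < size s) c i *: s`_i.

(* Only the values of [uop_fun] on [uop_dom] are meaningful. *)
Record unbounded_op (H : Type) : Type := UnboundedOp {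
  uop_dom : set H;
  uop_fun :> H -> H
}.

Definition uop_linear (R : realType) (H : lmodType R) (A : unbounded_op H)
    : Prop :=
  uop_dom A 0 /\
  forall (a : R) (u v : H), uop_dom A u -> uop_dom A v ->
    uop_dom A (a *: u + v) /\ A (a *: u + v) = a *: A u + A v.

(* [(v, w)] belongs to the graph of the adjoint of [A]. *)
Definition adjoint_graph (R : realType) (H : completeNormedModType R)
    (dot : {dot H for idfun}) (A : unbounded_op H) (v w : H) : Prop :=
  forall u, uop_dom A u -> dot (A u) v = dot u w.

Definition self_adjoint (R : realType) (H : completeNormedModType R)
    (dot : {dot H for idfun}) (A : unbounded_op H) : Prop :=
  [/\ uop_linear A,
      closure (uop_dom A) = setT &
      forall v w, adjoint_graph dot A v w <-> uop_dom A v /\ A v = w].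

Definition nonnegative_op (R : realType) (H : completeNormedModType R)
    (dot : {dot H for idfun}) (A : unbounded_op H) : Prop :=
  forall u, uop_dom A u -> 0 <= dot (A u) u.

Definition compact_op (R : realType) (H : completeNormedModType R)
    (K : {linear H -> H}) : Prop :=
  compact (closure (K @` [set u | `|u| <= 1])).

(* Some (equivalently, every) resolvent [(A - z)^-1] is compact. *)
Definition compact_resolvent (R : realType) (H : completeNormedModType R)
    (A : unbounded_op H) : Prop :=
  exists (z : R) (K : {linear H -> H}),
    [/\ forall f, uop_dom A (K f) /\ A (K f) - z *: K f = f,
        forall u, uop_dom A u -> K (A u - z *: u) = u &
        compact_op K].

Definition op_eigenspace (R : realType) (H : lmodType R) (A : unbounded_op H)
    (l : R) : set H :=
  [set u | uop_dom A u /\ A u = l *: u].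

Definition orth_proj (R : realType) (H : completeNormedModType R)
    (dot : {dot H for idfun}) (V : set H) (u : H) : H :=
  xget 0 [set p | V p /\ forall v, V v -> dot (u - p) v = 0].

Definition spectral_proj (R : realType) (H : completeNormedModType R)
    (dot : {dot H for idfun}) (A : unbounded_op H) (l : R) (u : H) : H :=
  orth_proj dot (op_eigenspace A l) u.

(* Functional calculus of a self-adjoint operator with compact resolvent: its
   spectral measure is the sum of the projections [E_l] onto the eigenspaces,
   so [f(A) u = \sum_l f(l) E_l u] with domain
   [{u | \sum_l f(l)^2 |E_l u|^2 < +oo}].  The sums are unordered and run over
   all reals; [E_l = 0] unless [l] is an eigenvalue. *)
Definition fcalc_dom (R : realType) (H : completeNormedModType R)
    (dot : {dot H for idfun}) (A : unbounded_op H) (f : R -> R) : set H :=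
  [set u | (esum [set: R]
     (fun l => ((f l) ^+ 2 * `|spectral_proj dot A l u| ^+ 2)%:E) < +oo)%E].

Definition fcalc (R : realType) (H : completeNormedModType R)
    (dot : {dot H for idfun}) (A : unbounded_op H) (f : R -> R) (u : H) : H :=
  summability.sum (fun l : R => f l *: spectral_proj dot A l u).

Definition Hs (R : realType) (H : completeNormedModType R)
    (dot : {dot H for idfun}) (A : unbounded_op H) (r : R) : set H :=
  fcalc_dom dot A (fun l => (1 + l) `^ (r / 2)).

Definition normHs (R : realType) (H : completeNormedModType R)
    (dot : {dot H for idfun}) (A : unbounded_op H) (r : R) (u : H) : R :=
  `|fcalc dot A (fun l => (1 + l) `^ (r / 2)) u|.

Definition ballHs (R : realType) (H : completeNormedModType R)
    (dot : {dot H for idfun}) (A : unbounded_op H) (r : R) (u : H) (d : R)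
    : set H :=
  [set v | Hs dot A r v /\ normHs dot A r (v - u) < d].

Definition nbhdHs (R : realType) (H : completeNormedModType R)
    (dot : {dot H for idfun}) (A : unbounded_op H) (r : R) (u : H) (U : set H)
    : Prop :=
  U `<=` Hs dot A r /\ exists2 d : R, 0 < d & ballHs dot A r u d `<=` U.

Definition openHs (R : realType) (H : completeNormedModType R)
    (dot : {dot H for idfun}) (A : unbounded_op H) (r : R) (U : set H)
    : Prop :=
  U `<=` Hs dot A r /\ forall u, U u -> nbhdHs dot A r u U.

Definition boundedHs (R : realType) (H : completeNormedModType R)
    (dot : {dot H for idfun}) (A : unbounded_op H) (r : R) (U : set H)
    : Prop :=
  exists M : R, forall u, U u -> normHs dot A r u <= M.

(* Operator norm from the subspace [D] normed by [n] to a space normed by [m];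
   [+oo] when the operator is unbounded. *)
Definition opnorm (R : realType) (H : Type) (D : set H) (n m : H -> R)
    (T : H -> H) : \bar R :=
  ereal_sup [set (m (T h))%:E | h in [set h | D h /\ n h <= 1]].

Definition norm_LH (R : realType) (H : completeNormedModType R)
    (T : H -> H) : \bar R :=
  opnorm setT (fun u : H => `|u|) (fun u : H => `|u|) T.

Definition norm_LH2H (R : realType) (H : completeNormedModType R)
    (dot : {dot H for idfun}) (A : unbounded_op H) (T : H -> H) : \bar R :=
  opnorm (Hs dot A 2) (normHs dot A 2) (fun u : H => `|u|) T.

Definition norm_LHH2 (R : realType) (H : completeNormedModType R)
    (dot : {dot H for idfun}) (A : unbounded_op H) (T : H -> H) : \bar R :=
  opnorm setT (fun u : H => `|u|) (normHs dot A 2) T.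

(* [T], restricted to [H^2], is a bounded linear bijection onto [H] with
   bounded inverse. *)
Definition isomorphism_H2H (R : realType) (H : completeNormedModType R)
    (dot : {dot H for idfun}) (A : unbounded_op H) (T : H -> H) : Prop :=
  [/\ forall (a : R) (u v : H), Hs dot A 2 u -> Hs dot A 2 v ->
        T (a *: u + v) = a *: T u + T v,
      (norm_LH2H dot A T < +oo)%E &
      exists S : {linear H -> H},
        [/\ forall f, Hs dot A 2 (S f) /\ T (S f) = f,
            forall u, Hs dot A 2 u -> S (T u) = u &
            (norm_LHH2 dot A S < +oo)%E]].

(* [T] restricted to [H^2] is the Frechet derivative at [u] of [F], seen as a
   map from an open subset of [H^2] to [H]. *)
Definition frechet_H2H (R : realType) (H : completeNormedModType R)
    (dot : {dot H for idfun}) (A : unbounded_op H) (F : H -> H) (u : H)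
    (T : {linear H -> H}) : Prop :=
  (norm_LH2H dot A T < +oo)%E /\
  forall e : R, 0 < e -> exists2 d : R, 0 < d &
    forall h, Hs dot A 2 h -> normHs dot A 2 h < d ->
      `|F (u + h) - F u - T h| <= e * normHs dot A 2 h.

(* [DF u] is the extension to [H] of the derivative at [u] of the restriction
   of [F] to [U]; its values outside [U] are irrelevant. *)
Definition regular_on (R : realType) (H : completeNormedModType R)
    (dot : {dot H for idfun}) (A : unbounded_op H) (U : set H) (F : H -> H)
    (DF : H -> {linear H -> H}) : Prop :=
  [/\ forall u, U u -> frechet_H2H dot A F u (DF u),
      forall u, U u -> forall e : R, 0 < e -> exists2 d : R, 0 < d &
        forall v, U v -> normHs dot A 2 (v - u) < d ->
          (norm_LH2H dot A (fun h => DF v h - DF u h)%R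
             <= e%:E)%E &
      exists C L : R, [/\ 0 < C, 0 < L,
        (ereal_sup [set norm_LH (DF u) | u in U] <= C%:E)%E &
        forall u v, U u -> U v ->
          (norm_LH (fun h => DF u h - DF v h)%R
             <= (L * normHs dot A 2 (u - v))%:E)%E]].

Definition equilibrium (H : Type) (T : unbounded_op H) (F : H -> H) (u : H)
    : Prop :=
  uop_dom T u /\ T u = F u.

Definition nondegenerate_at (R : realType) (H : completeNormedModType R)
    (dot : {dot H for idfun}) (A : unbounded_op H) (DF : H -> {linear H -> H})
    (u : H) : Prop :=
  isomorphism_H2H dot A (fun h => A h - DF u h).

Definition P_eps (R : realType) (H : completeNormedModType R)
    (dot : {dot H for idfun}) (A : unbounded_op H) (mu eps : R) (u : H) : H :=
  fcalc dot A (\1_(`[0, mu * eps ^- 2]%classic)) u.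

Definition Q_eps (R : realType) (H : completeNormedModType R)
    (dot : {dot H for idfun}) (A : unbounded_op H) (mu eps : R) (u : H) : H :=
  u - P_eps dot A mu eps u.

Definition A_eps (R : realType) (H : completeNormedModType R)
    (dot : {dot H for idfun}) (A : unbounded_op H) (mu eps : R)
    : unbounded_op H :=
  UnboundedOp (uop_dom A) (fun u => A u + eps^-1 *: Q_eps dot A mu eps u).

(* Locally unique continuation of [ustar] to equilibria [ueps eps] of
   [v' + A_eps v = F v], for [0 < eps <= eps0], within the error [err eps];
   the neighborhood [Ustar] does not depend on [eps]. *)
Definition persists (R : realType) (H : completeNormedModType R)
    (dot : {dot H for idfun}) (A : unbounded_op H) (mu : R) (F : H -> H)
    (ustar : H) (eps0 : R) (Ustar : set H) (err : R -> R) : Prop :=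
  exists ueps : R -> H, forall eps : R, 0 < eps <= eps0 ->
    [/\ Ustar (ueps eps),
        equilibrium (A_eps dot A mu eps) F (ueps eps),
        normHs dot A 2 (ueps eps - ustar) <= err eps &
        forall v, Ustar v -> equilibrium (A_eps dot A mu eps) F v ->
          v = ueps eps].

(* Main.v *)
Require Import Defs.
From HB Require Import structures.
From mathcomp Require Import all_boot all_order all_algebra sesquilinear.
From mathcomp Require Import all_classical all_reals all_analysis.
From mathcomp Require summability.
From mathcomp Require Import finmap ring lra.
Import Order.TTheory GRing.Theory Num.Theory numFieldNormedType.Exports.
Local Open Scope classical_set_scope.
Local Open Scope ring_scope.

(* Expanding in eigenvectors of [A] gives, for [u] in [H^r],
   [|Q_eps u| <= (mu eps^-2)^(-r/2) |u|_r].  For [r = 2] this says that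
   [eps^-1 Q_eps : H^2 -> H] has norm at most [eps / mu], so that [A_eps] is a
   small perturbation of [A] as an operator from [H^2] to [H], and the
   equilibrium is continued by the contraction principle; for general [r] it
   bounds the residual [eps^-1 Q_eps ustar], hence the displacement, by a
   multiple of [eps^(r - 1) |ustar|_r].  The expansion itself rests on the
   spectral theorem for the compact symmetric resolvent of [A]. *)

(** [orth_proj] and [summability.sum], hence [fcalc], are total functions with default values, so
    nothing can be read off them before existence and convergence are established. After that the
    arguments run one eigenspace at a time: a vector is determined by its components ([proj_ext]),
    and norms compare when components do ([norm_le_proj]). The contraction acts on
    [f = L (v - ustar)], with [L = A - DF ustar], because [H] is the complete space at hand, while
    [H^2] is only a subset carrying a norm; the inverse of [L] brings [f] back to [H^2]. Uniqueness
    on the [H^2] ball is a separate estimate in the [H^2] norm, since the [f] of a competing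
    equilibrium may lie outside the ball of [H] on which the map contracts. *)

Set Implicit Arguments.
Unset Strict Implicit.
Unset Printing Implicit Defensive.

(** * Hilbert space geometry *)

Section hilbert.
Context (R : realType) (H : completeNormedModType R) (dot : {dot H for idfun}).
Hypothesis Hdot : induces_norm dot.
Implicit Types (u v w : H) (V : set H).

Lemma dotC u v : dot u v = dot v u.
Proof. by rewrite hermC /= expr0 mul1r. Qed.

Lemma dotBl u v w : dot (u - v) w = dot u w - dot v w.
Proof. exact: linearBl. Qed.

Lemma dotBr u v w : dot u (v - w) = dot u v - dot u w.
Proof. exact: linearBr. Qed.

Lemma dotDl u v w : dot (u + v) w = dot u w + dot v w.
Proof. exact: linearDl. Qed.

Lemma dotDr u v w : dot u (v + w) = dot u v + dot u w.
Proof. exact: linearDr. Qed.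

Lemma dotNl u v : dot (- u) v = - dot u v.
Proof. exact: linearNl. Qed.

Lemma dotZl a u v : dot (a *: u) v = a * dot u v.
Proof. exact: linearZl_LR. Qed.

Lemma dotZr a u v : dot u (a *: v) = a * dot u v.
Proof. exact: linearZr_LR. Qed.

Lemma dot0l u : dot 0 u = 0.
Proof. exact: linear0l. Qed.

Lemma dot0r u : dot u 0 = 0.
Proof. exact: linear0r. Qed.

Lemma dot_suml I (r : seq I) (f : I -> H) u :
  dot (\sum_(i <- r) f i) u = \sum_(i <- r) dot (f i) u.
Proof. exact: linear_sumlz. Qed.

Lemma sqr_normB u v : `|u - v| ^+ 2 = `|u| ^+ 2 - 2 * dot u v + `|v| ^+ 2.
Proof. rewrite -!Hdot dotBl !dotBr (dotC v u); ring. Qed.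

Lemma sqr_normD u v : `|u + v| ^+ 2 = `|u| ^+ 2 + 2 * dot u v + `|v| ^+ 2.
Proof.
rewrite -!Hdot dotDl !dotDr (dotC v u); ring.
Qed.

(** Expanding the square of the norm of [|v| u - |u| v] and cancelling [|u| |v|]; this is why zero
    vectors are treated apart. *)
Lemma dot_le u v : dot u v <= `|u| * `|v|.
Proof.
have [->|v0] := eqVneq v 0; first by rewrite dot0r normr0 mulr0.
have vp : 0 < `|v| by rewrite normr_gt0.
have := sqr_ge0 `| `|v| *: u - `|u| *: v|.
rewrite sqr_normB !normrZ !normr_id dotZl dotZr => h.
have [->|u0] := eqVneq u 0; first by rewrite dot0l normr0 mul0r.
have up : 0 < `|u| by rewrite normr_gt0.
have uv : 0 < `|u| * `|v| by rewrite mulr_gt0.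
rewrite -(ler_pM2l uv); nra.
Qed.

Lemma normr_dot_le u v : `|dot u v| <= `|u| * `|v|.
Proof.
by rewrite ler_norml dot_le andbT lerNl -dotNl (le_trans (dot_le _ _))// normrN.
Qed.

(** Pairing with an arbitrary [w] turns vector identities into scalar ones, which [ring] can
    settle. *)
Lemma dot_inj u v : (forall w, dot u w = dot v w) -> u = v.
Proof.
move=> h; apply/eqP; rewrite -subr_eq0 -normr_eq0 -sqrf_eq0 -Hdot dotBl h.
by rewrite subrr.
Qed.

Lemma cvg_dot (T : Type) (F : set_system T) {FF : Filter F} (f : T -> H) l w :
  f @ F --> l -> dot (f x) w @[x --> F] --> dot l w.
Proof.
move=> /cvgrPdist_lt fl; apply/cvgrPdist_le => e e0.
have w0 : 0 < `|w| + 1 by rewrite ltr_wpDl.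
have := fl _ (divr_gt0 e0 w0); apply: filterS => x.
rewrite ltr_pdivlMr// -dotBl => h.
apply: le_trans (normr_dot_le _ _) (le_trans _ (ltW h)).
by rewrite ler_wpM2l// lerDl.
Qed.

Definition linear_subspace V :=
  V 0 /\ forall a u v, V u -> V v -> V (a *: u + v).

Lemma closed_annihilator (S : set H) :
  closed [set v | forall u, S u -> dot u v = 0].
Proof.
rewrite [X in closed X](_ : _ =
  \bigcap_(u in S) (fun v => dot v u) @^-1` [set 0]); last first.
  by apply/seteqP; split => v h u /h; rewrite /= dotC.
apply: closed_bigI => u _.
apply: closed_comp; last exact: closed_eq.
by move=> x _; apply: cvg_dot.
Qed.

(* A minimizing filter for the distance to [V] is Cauchy by the parallelogram
   law. *)
Lemma projection_exists V u : linear_subspace V -> closed V ->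
  exists p, V p /\ forall v, V v -> dot (u - p) v = 0.
Proof.
move=> [V0 Vl] Vc.
pose S := [set `|u - v| ^+ 2 | v in V].
have Slb : has_lbound S by exists 0 => _ [v _ <-]; rewrite sqr_ge0.
have Sinf : has_inf S by split=> //; exists (`|u - 0| ^+ 2), 0.
pose D := inf S.
have DS v : V v -> D <= `|u - v| ^+ 2.
  by move=> Vv; apply: ge_inf => //; exists v.
pose B (e : R) := [set v | V v /\ `|u - v| ^+ 2 < D + e].
pose F := filter_from [set e : R | 0 < e] B.
have FF : ProperFilter F.
  apply: filter_from_proper.
    apply: filter_from_filter; first by exists 1 => /=.
    move=> e e' /= e0 e'0; exists (Num.min e e'); first by rewrite /= lt_min e0.
    move=> v [Vv]; rewrite minEle => h.
    by split; split=> //; apply: lt_le_trans h _; case: ifP => hh; lra.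
  move=> e e0; have [_ [v Vv <-] h] := inf_adherent e0 Sinf.
  by exists v; split.
have FB (e : R) : 0 < e -> F (B e) by move=> e0; exists e.
have Fc : cvg F.
  apply: cauchy_cvg; apply: cauchy_exP => e e0.
  (* The parallelogram law at the midpoint, which is at squared distance at least [D], bounds
     [|v - w| ^ 2] by four times the excess over [D]. *)
  have d0 : 0 < e ^+ 2 / 4 by rewrite divr_gt0// exprn_gt0.
  have [_ [v Vv <-] h] := inf_adherent d0 Sinf.
  exists v; apply: (filterS _ (FB _ d0)) => w [Vw hw].
  rewrite -ball_normE /ball_ /=.
  have e1 : v - w = (u - w) - (u - v) by rewrite opprB [RHS]addrC addrA subrK.
  have Vm : V (2^-1 *: (v + w)).
    rewrite scalerDr; apply: (Vl) => //.
    by rewrite -[_ *: w]addr0; apply: (Vl).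
  have := DS _ Vm.
  have -> : u - 2^-1 *: (v + w) = 2^-1 *: ((u - w) + (u - v)).
    rewrite addrACA -opprD (addrC w) scalerBr -mulr2n -[u *+ 2]scaler_nat scalerA.
    by rewrite mulVf ?pnatr_eq0// scale1r.
  rewrite normrZ exprMn sqr_normD => h2.
  rewrite -(ltr_pXn2r (n := 2))// ?nnegrE ?(ltW e0)// e1 sqr_normB.
  move: h h2; rewrite -/D ger0_norm ?invr_ge0// => h h2.
  lra.
have Fp := Fc; set p := lim F in Fp.
have Vp : V p.
  have : V (lim (id @ F)).
    apply: (closed_cvg (F := F) (u_ := id)) => //.
    by apply: filterS (FB _ ltr01) => x [].
  by rewrite /p.
have Dp : `|u - p| ^+ 2 <= D.
  apply/ler_addgt0Pr => e e0.
  have c1 : `|u - x| ^+ 2 @[x --> F] --> `|u - p| ^+ 2.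
    have c0 : `|u - x| @[x --> F] --> `|u - p|.
      by apply: cvg_norm; apply: cvgB => //; exact: cvg_cst.
    by rewrite expr2; apply: cvgM.
  apply: (closed_cvg (fun y : R => y <= D + e)) c1; first exact: closed_le.
  by apply: filterS (FB _ e0) => x [_ /ltW].
exists p; split => // v Vv.
have [->|v0] := eqVneq v 0; first by rewrite dot0r.
have vp : 0 < `|v| ^+ 2 by rewrite exprn_gt0// normr_gt0.
(* Moving from [p] by [t v] lowers the squared distance by [t ^ 2 |v| ^ 2], so minimality forces
   [t = 0]. *)
pose t := dot (u - p) v / `|v| ^+ 2.
have : D <= `|u - (t *: v + p)| ^+ 2 by apply: DS; apply: (Vl).
rewrite opprD (addrC (- (_ *: _))) addrA sqr_normB dotZr normrZ exprMn.
rewrite real_normK ?num_real//.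
have tE : dot (u - p) v = t * `|v| ^+ 2 by rewrite divfK// gt_eqF.
rewrite tE => h.
suff -> : t = 0 by rewrite mul0r.
apply/eqP; rewrite -sqrf_eq0 eq_le sqr_ge0 andbT -(pmulr_lle0 _ vp).
move: h Dp; set N := `|v| ^+ 2; nra.
Qed.

End hilbert.

(** * Unordered sums of real families *)

Section esum_fset.
Context (R : realType) (I : choiceType).
Implicit Types (a : I -> R) (A : {fset I}).

Lemma fsbig_fset a A :
  (\sum_(i \in [set` A]) (a i)%:E)%E = (\sum_(i <- A) a i)%:E.
Proof. by rewrite fsbig_finite//= set_fsetK sumEFin. Qed.

Lemma le_sum_esum a A :
  ((\sum_(i <- A) a i)%:E <= esum [set: I] (fun i => (a i)%:E))%E.
Proof.
apply: esum_ge; exists [set` A]; last by rewrite fsbig_fset.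
by split=> //; exact: finite_fset.
Qed.

Lemma esum_le_sums a (c : R) : (forall A, \sum_(i <- A) a i <= c) ->
  (esum [set: I] (fun i => (a i)%:E) <= c%:E)%E.
Proof.
move=> h; apply: ge_ereal_sup => _ [X [Xf _] <-].
by rewrite fsbig_finite//= sumEFin lee_fin.
Qed.

(** Any finite set whose sum is within [e] of the total works, because no finite sum exceeds the
    total. *)
Lemma esum_tail a (e : R) : (forall i, 0 <= a i) ->
  (esum [set: I] (fun i => (a i)%:E) < +oo)%E -> 0 < e ->
  exists A, forall B, (A `<=` B)%fset ->
    \sum_(i <- B) a i - \sum_(i <- A) a i < e.
Proof.
move=> a0 afin e0.
set s := esum _ _ in afin.
have sfin : s \is a fin_num.
  by rewrite ge0_fin_numE//; apply: esum_ge0 => i _; rewrite lee_fin.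
have [_ [X [Xf _] <-]] := ub_ereal_sup_adherent e0 sfin.
rewrite fsbig_finite//= sumEFin => h.
have {}h : (s - e%:E < (\sum_(i <- fset_set X) a i)%:E)%E := h.
exists (fset_set X) => B _.
have := le_sum_esum a B; rewrite -/s.
move: sfin h; case: s {afin} => // r _; rewrite -EFinB lte_fin lee_fin.
lra.
Qed.
End esum_fset.

(** * Unordered orthogonal series *)

Section orthogonal_sums.
Context (R : realType) (H : completeNormedModType R) (dot : {dot H for idfun}).
Hypothesis Hdot : induces_norm dot.
Context (I : choiceType) (x : I -> H).
Hypothesis x_orth : forall i j, i != j -> dot (x i) (x j) = 0.

Lemma sqr_norm_orth_sum (A : {fset I}) :
  `|\sum_(i <- A) x i| ^+ 2 = \sum_(i <- A) `|x i| ^+ 2.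
Proof.
rewrite -Hdot dot_suml. rewrite big_seq [RHS]big_seq; apply: eq_bigr => i iA.
rewrite (dotC dot) dot_suml (big_fsetD1 i)//= Hdot big_seq big1 ?addr0// => j.
by rewrite !inE => /andP[ji _]; exact: x_orth.
Qed.

Lemma partial_sumE (A : {fset I}) :
  summability.partial_sum x A = \sum_(i <- A) x i.
Proof. by rewrite /summability.partial_sum big_seq_fsetE. Qed.

(** By Pythagoras the squared distance between two nested partial sums is a tail of the numerical
    series, so the net is Cauchy. *)
Lemma orth_sum_cvg :
  (esum [set: I] (fun i => (`|x i| ^+ 2)%:E) < +oo)%E ->
  (fun A : {fset I} => \sum_(i <- A) x i) @ summability.totally -->
    summability.sum x.
Proof.
move=> fin.
have FF := @summability.totally_filter I.
have E : summability.partial_sum x = fun A : {fset I} => \sum_(i <- A) x i.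
  by apply/funext => A; rewrite partial_sumE.
rewrite /summability.sum E.
apply: cauchy_cvg; apply: cauchy_exP => e e0.
have [A hA] := esum_tail (fun i => sqr_ge0 `|x i|) fin (exprn_gt0 2 e0).
exists (\sum_(i <- A) x i); exists A => //= B /= AB.
rewrite -ball_normE /ball_ /=.
rewrite -(ltr_pXn2r (n := 2))// ?nnegrE ?(ltW e0)//.
apply: le_lt_trans (hA B AB).
rewrite (big_fsetID _ (mem A) B)/= (big_fsetID _ (mem A) B)/=.
have -> : [fset i in B | mem A i]%fset = A.
  apply/fsetP => i; rewrite !inE/= andbC; case iA: (i \in A) => //=.
  by rewrite (fsubsetP AB).
rewrite opprD addrA subrr sub0r normrN (addrC (\sum_(_ <- A) _)) addrK.
by rewrite sqr_norm_orth_sum.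
Qed.

End orthogonal_sums.

(** * Eigenvectors of a compact symmetric injective operator *)

Section compact_symmetric.
Context (R : realType) (H : completeNormedModType R) (dot : {dot H for idfun}).
Hypothesis Hdot : induces_norm dot.
Context (K : {linear H -> H}).
Hypotheses (Kcpt : compact_op K) (Ksym : forall u v, dot (K u) v = dot u (K v))
  (Kinj : forall u, K u = 0 -> u = 0).

Let eigenvector : set H := [set e | exists2 k : R, k != 0 & K e = k *: e].
(** The orthogonal complement of the eigenvectors: a closed subspace stable under [K], to be shown
    trivial by finding an eigenvector in it. *)
Let M : set H := [set v | forall e, eigenvector e -> dot e v = 0].

Let M_closed : closed M. Proof. exact: closed_annihilator. Qed.

Let M_lin a u v : M u -> M v -> M (a *: u + v).
Proof. by move=> hu hv e he; rewrite dotDr dotZr hu// hv// mulr0 addr0. Qed.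

Let MZ a u : M u -> M (a *: u).
Proof.
by move=> hu; rewrite -[_ *: _]addr0; apply: M_lin => // e _; rewrite dot0r.
Qed.

Let MB u v : M u -> M v -> M (u - v).
Proof. by move=> hu hv; rewrite addrC -scaleN1r; exact: M_lin. Qed.

Let M_stable u : M u -> M (K u).
Proof.
move=> hu e he; have [k _ eE] := he.
by rewrite -Ksym eE dotZl hu// mulr0.
Qed.

(* The squared norm [k ^+ 2] of [K] on [M] is an eigenvalue of [K ^ 2]: the
   images under [K] of a maximizing filter cluster at an eigenvector. *)
Let norm_attained w : M w -> w != 0 ->
  exists (k : R) (g : H), [/\ 0 < k, g != 0, M g & K (K g) = k ^+ 2 *: g].
Proof.
move=> Mw w0.
pose B := [set f : H | M f /\ `|f| <= 1].
pose S := [set `|K f| | f in B].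
have [b hb] : exists b : R, forall f, `|f| <= 1 -> `|K f| <= b.
  have [b [_ hb]] := compact_bounded Kcpt.
  exists (b + 1) => f f1; apply: (hb (b + 1)); first by rewrite ltrDl.
  apply: subset_closure.
  by exists f.
have Ssup : has_sup S.
  split; last by exists b => _ [f [_ f1] <-]; exact: hb.
  by exists `|K 0|, 0 => //; split; rewrite ?normr0// => e _; rewrite dot0r.
pose k := sup S.
have KB f : B f -> `|K f| <= k.
  by move=> Bf; apply: sup_ubound => //; [case: Ssup|exists f].
have BN u : M u -> u != 0 -> B (`|u|^-1 *: u).
  move=> Mu u0; split; first exact: MZ.
  by rewrite normrZ normfV normr_id mulVf// normr_eq0.
have KM u : M u -> `|K u| <= k * `|u|.
  move=> Mu; have [->|u0] := eqVneq u 0; first by rewrite linear0 normr0 mulr0.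
  have := KB _ (BN _ Mu u0); rewrite linearZ normrZ normfV normr_id.
  by rewrite mulrC ler_pdivrMr// normr_gt0.
have k0 : 0 < k.
  apply: lt_le_trans (KB _ (BN _ Mw w0)); rewrite normr_gt0.
  apply/eqP => /Kinj /eqP; rewrite scaler_eq0 invr_eq0 normr_eq0 (negbTE w0).
  by [].
pose T (e : R) := [set f | B f /\ k ^+ 2 - e < `|K f| ^+ 2].
pose F := filter_from [set e : R | 0 < e] (fun e => K @` T e).
have FF : ProperFilter F.
  apply: filter_from_proper.
    apply: filter_from_filter; first by exists 1 => /=.
    move=> e e' /= e0 e'0; exists (Num.min e e'); first by rewrite /= lt_min e0.
    move=> x [f [Bf]]; rewrite minEle => h <-.
    by split; exists f => //; split=> //; apply: le_lt_trans h;
      case: ifP => hh; lra.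
  move=> e /= e0.
  (* For [m] this minimum, [k - m] is nonnegative and [(k - m) ^ 2 >= k ^ 2 - 2 k m >= k ^ 2 -
     e]. *)
  have d0 : 0 < Num.min k (e / (2 * k)) by rewrite lt_min k0 divr_gt0// mulr_gt0.
  have [_ [f Bf <-] h] := sup_adherent d0 Ssup.
  exists (K f), f => //; split => //.
  have h1 : k - k <= k - Num.min k (e / (2 * k)) by rewrite lerD2l lerN2 ge_min lexx.
  have h2 : Num.min k (e / (2 * k)) * (2 * k) <= e.
    by rewrite -ler_pdivlMr ?mulr_gt0// ge_min lexx orbT.
  move: h h1 h2; rewrite -/k; set m := Num.min _ _ in d0 *; set n := `|K f|.
  nra.
have [g [_ clg]] : closure (K @` [set u | `|u| <= 1]) `&` cluster F !=set0.
  apply: Kcpt; exists 1 => //=.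
  by move=> _ [f [[_ f1] _] <-]; apply: subset_closure; exists f.
have approx (e d : R) : 0 < e -> 0 < d ->
    exists f, [/\ B f, k ^+ 2 - e < `|K f| ^+ 2 & `|g - K f| < d].
  move=> e0 d0.
  have := clg (K @` T e) (ball g d).
  case; [by exists e|exact: nbhsx_ballx|].
  move=> _ [[f [Bf h] <-]]; rewrite -ball_normE => hd.
  by exists f; split.
have Mg : M g.
  apply: M_closed => X /nbhs_ballP [d /= d0 dX].
  have [f [[Mf _] _ h]] := approx 1 d ltr01 d0.
  exists (K f); split; first exact: M_stable.
  by apply: dX; rewrite -ball_normE.
exists k, g; split => //.
  apply/eqP => g0.
  (* If [g = 0], these tolerances give both [|K f| < k / 2] and [|K f| ^ 2 > 3 k ^ 2 / 4]. *)
  have [||f [_ ]] := approx (k ^+ 2 / 4) (k / 2).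
  - by rewrite divr_gt0// exprn_gt0.
  - by rewrite divr_gt0.
  rewrite g0 sub0r normrN; have := normr_ge0 (K f); nra.
apply/eqP; rewrite -subr_eq0 -normr_le0; apply/ler_addgt0Pr => e e0.
rewrite add0r.
(* [K (K g) - k ^ 2 g] is split below into three terms, each of norm at most [k ^ 2 d = e / 3]. *)
pose d := e / (3 * k ^+ 2).
have d0 : 0 < d by rewrite divr_gt0// mulr_gt0// exprn_gt0.
have eE : e = 3 * (k ^+ 2 * d) by rewrite /d; field; rewrite gt_eqF.
have [|f [[Mf f1] hf hd]] := approx (d ^+ 2) d _ d0; first by rewrite exprn_gt0.
have Mgf : M (g - K f) by apply: MB => //; exact: M_stable.
have h1 : `|K (K (g - K f))| <= k ^+ 2 * d.
  apply: le_trans (KM _ (M_stable Mgf)) _.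
  rewrite expr2 -mulrA ler_pM2l//; apply: le_trans (KM _ Mgf) _.
  by rewrite ler_pM2l// ltW.
have Mh : M (K (K f) - k ^+ 2 *: f).
  by apply: MB; [do 2!apply: M_stable|exact: MZ].
(* A near-maximizer is nearly an eigenvector of [K ^ 2]: by symmetry the square is [|K (K f)| ^ 2 -
   2 k ^ 2 |K f| ^ 2 + k ^ 4 |f| ^ 2], at most [k ^ 2 (k ^ 2 - |K f| ^ 2)]. *)
have h2 : `|K (K f) - k ^+ 2 *: f| <= k * d.
  rewrite -(ler_pXn2r (n := 2))// ?nnegrE ?(mulr_ge0 (ltW k0) (ltW d0))//.
  rewrite (exprMn _ k d) (sqr_normB Hdot) dotZr Ksym (Hdot (K f)) normrZ exprMn.
  rewrite ger0_norm ?sqr_ge0//.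
  have a1 := KM _ (M_stable Mf).
  have a2 : `|K (K f)| ^+ 2 <= k ^+ 2 * `|K f| ^+ 2.
    by rewrite -exprMn ler_pXn2r// nnegrE// mulr_ge0// ltW.
  have a3 : `|f| ^+ 2 <= 1 by rewrite expr_le1.
  have a4 : (k ^+ 2) ^+ 2 * `|f| ^+ 2 <= (k ^+ 2) ^+ 2.
    by rewrite ler_piMr// sqr_ge0.
  have kk : 0 < k ^+ 2 by rewrite exprn_gt0.
  have a5 : k ^+ 2 * (k ^+ 2 - d ^+ 2) <= k ^+ 2 * `|K f| ^+ 2.
    by rewrite ler_pM2l// ltW.
  lra.
have h3 : `|K (K (K f)) - k ^+ 2 *: K f| <= k ^+ 2 * d.
  rewrite -linearZ -linearB; apply: le_trans (KM _ Mh) _.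
  by rewrite expr2 -mulrA ler_pM2l.
have h4 : `|k ^+ 2 *: (K f - g)| <= k ^+ 2 * d.
  rewrite normrZ ger0_norm ?sqr_ge0// distrC.
  by rewrite ler_pM2l ?exprn_gt0// ltW.
have -> : K (K g) - k ^+ 2 *: g = K (K (g - K f)) +
    ((K (K (K f)) - k ^+ 2 *: K f) + k ^+ 2 *: (K f - g)).
  rewrite scalerBr [_ + (_ *: K f - _)]addrA subrK addrA; congr (_ - _).
  by rewrite -!linearD subrK.
rewrite eE; apply: le_trans (ler_normD _ _) _.
have := ler_normD (K (K (K f)) - k ^+ 2 *: K f) (k ^+ 2 *: (K f - g)).
lra.
Qed.

(** Factor [K ^ 2 - k ^ 2 = (K - k)(K + k)]. The vector [K g + k g] is an eigenvector lying in [M],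
    hence orthogonal to itself and zero; then [g] is an eigenvector for [- k] lying in [M], hence
    zero too. *)
Lemma compact_symmetric_total w :
  (forall e k, k != 0 -> K e = k *: e -> dot e w = 0) -> w = 0.
Proof.
move=> hw; apply/eqP/negP => /negP w0.
have Mw : M w by move=> e [k k0 ke]; exact: hw ke.
have [k [g [k0 g0 Mg Kg]]] := norm_attained Mw w0.
pose e := K g + k *: g.
have Ke : K e = k *: e by rewrite /e linearD linearZ /= Kg scalerDr scalerA -expr2 addrC.
have Me : M e by rewrite /e addrC; apply: M_lin => //; exact: M_stable.
have e0 : e = 0.
  have : dot e e = 0 by apply: Me; exists k; rewrite ?gt_eqF.
  by rewrite Hdot => /eqP; rewrite expf_eq0 /= normr_eq0 => /eqP.
have : dot g g = 0.
  apply: Mg; exists (- k); first by rewrite oppr_eq0 gt_eqF.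
  by apply/eqP; rewrite scaleNr -addr_eq0 -/e e0.
by rewrite Hdot => /eqP; rewrite expf_eq0 /= normr_eq0 (negbTE g0).
Qed.

End compact_symmetric.

(** * Spectral decomposition and functional calculus of [A] *)

Section spectral.
Context (R : realType) (H : completeNormedModType R) (dot : {dot H for idfun})
  (A : unbounded_op H).
Hypotheses (Hdot : induces_norm dot) (HAsa : self_adjoint dot A)
  (HAnn : nonnegative_op dot A) (HAcr : compact_resolvent A).
Implicit Types (u v w : H) (l : R).

Local Notation dom := (uop_dom A).
Local Notation V := (op_eigenspace A).
Local Notation E := (spectral_proj dot A).

Let dom0 : dom 0. Proof. by case: HAsa => -[]. Qed.

Let dom_lin a u v : dom u -> dom v ->
  dom (a *: u + v) /\ A (a *: u + v) = a *: A u + A v.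
Proof. by case: HAsa => -[_ h] _ _; exact: h. Qed.

Lemma uop0 : A 0 = 0.
Proof.
have [_] := dom_lin 1 dom0 dom0.
by rewrite !scale1r addr0 -{1}[A 0]addr0 => /addrI.
Qed.

Lemma uopZ a u : dom u -> dom (a *: u) /\ A (a *: u) = a *: A u.
Proof.
by move=> du; have := dom_lin a du dom0; rewrite uop0 !addr0.
Qed.

Lemma uopD u v : dom u -> dom v -> dom (u + v) /\ A (u + v) = A u + A v.
Proof. by move=> du dv; have := dom_lin 1 du dv; rewrite !scale1r. Qed.

Lemma uopB u v : dom u -> dom v -> dom (u - v) /\ A (u - v) = A u - A v.
Proof.
move=> du dv; rewrite -scaleN1r addrC.
by have := dom_lin (-1) dv du; rewrite !scaleN1r [- A v + _]addrC.
Qed.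

Lemma uop_sym u v : dom u -> dom v -> dot (A u) v = dot u (A v).
Proof. by case: HAsa => _ _ h du dv; have [_ ->] := h v (A v). Qed.

Let uop_adjoint v w : (forall u, dom u -> dot (A u) v = dot u w) ->
  dom v /\ A v = w.
Proof. by case: HAsa => _ _ h; case: (h v w). Qed.

Lemma eigenspace_subspace l : linear_subspace (V l).
Proof.
split; first by split; rewrite ?scaler0 ?uop0.
move=> a u v [du uE] [dv vE]; have [dw wE] := dom_lin a du dv.
by split=> //; rewrite wE uE vE scalerDr !scalerA mulrC.
Qed.

(** [A] need not be continuous, but self-adjointness makes the eigenspace the annihilator of the
    range of [A - l]. *)
Lemma eigenspace_closed l : closed (V l).
Proof.
rewrite (_ : V l =
  [set v | forall w, [set A u - l *: u | u in dom] w -> dot w v = 0]).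
  exact: closed_annihilator.
apply/seteqP; split => v /=.
  move=> [dv vE] _ [u du <-].
  by rewrite dotBl uop_sym// vE dotZl dotZr subrr.
move=> h; apply: uop_adjoint => u du.
have := h (A u - l *: u); rewrite dotBl dotZl dotZr => h'.
by apply/eqP; rewrite -subr_eq0 h'//; exists u.
Qed.

Lemma eigenspace_orth l m u v : l != m -> V l u -> V m v -> dot u v = 0.
Proof.
move=> lm [du uE] [dv vE]; have := uop_sym du dv.
rewrite uE vE dotZl dotZr => /eqP; rewrite -subr_eq0 -mulrBl mulf_eq0 subr_eq0.
by rewrite (negbTE lm) => /eqP.
Qed.

Lemma eigenvalue_ge0 l u : V l u -> u != 0 -> 0 <= l.
Proof.
move=> [du uE] u0; have := HAnn du; rewrite uE dotZl Hdot.
by rewrite pmulr_lge0// exprn_gt0// normr_gt0.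
Qed.

(** The resolvent inherits symmetry from [A] and is injective, and its eigenvectors for [k] are
    eigenvectors of [A] for [z + k^-1]. *)
Lemma eigenspaces_total w : (forall l u, V l u -> dot u w = 0) -> w = 0.
Proof.
case: HAcr => z [K [Kr Kl Kc]] h.
apply: (compact_symmetric_total Hdot Kc).
- move=> u v; have [du uE] := Kr u; have [dv vE] := Kr v.
  rewrite -{2}uE -{1}vE dotBl dotBr uop_sym//.
  by rewrite dotZl dotZr.
- by move=> u Ku; have [_] := Kr u; rewrite Ku scaler0 subr0 uop0.
- move=> e k k0 Ke; apply: (h (z + k^-1)).
  have [d dE] := Kr e.
  have eE : e = k^-1 *: K e by rewrite Ke scalerA mulVf// scale1r.
  have [de De] : dom e /\ A e = k^-1 *: A (K e).
    by rewrite {1 2}eE; exact: uopZ.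
  split=> //; rewrite De; move/eqP: dE; rewrite subr_eq => /eqP ->.
  by rewrite Ke scalerDr [z *: _]scalerA scalerA mulrCA mulVf// mulr1 addrC scalerDl.
Qed.

(** Existence of the projection rules out the default value of [xget]. *)
Lemma spectral_projP l u :
  V l (E l u) /\ forall v, V l v -> dot (u - E l u) v = 0.
Proof.
have [p pP] :=
  projection_exists Hdot u (eigenspace_subspace l) (@eigenspace_closed l).
have ex : [set q | V l q /\ forall v, V l v -> dot (u - q) v = 0] !=set0.
  by exists p.
exact: (xgetPex 0 ex).
Qed.

Lemma dot_proj l u v : V l v -> dot (E l u) v = dot u v.
Proof.
move=> vV; have [_ /(_ _ vV)] := spectral_projP l u.
by rewrite dotBl => /eqP; rewrite subr_eq0 => /eqP.
Qed.

Lemma proj_unique l u p : V l p -> (forall v, V l v -> dot p v = dot u v) ->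
  E l u = p.
Proof.
move=> pV h; apply/eqP; rewrite -subr_eq0; apply/eqP.
have [EV _] := spectral_projP l u.
have dV : V l (E l u - p).
  rewrite addrC -scaleN1r; exact: (eigenspace_subspace l).2.
have : dot (E l u - p) (E l u - p) = 0 by rewrite dotBl dot_proj// h// subrr.
by rewrite Hdot => /eqP; rewrite expf_eq0 /= normr_eq0 => /eqP.
Qed.

Lemma proj_lin l a u v : E l (a *: u + v) = a *: E l u + E l v.
Proof.
have [[uV _] [vV _]] := (spectral_projP l u, spectral_projP l v).
apply: proj_unique; first exact: (eigenspace_subspace l).2.
by move=> w wV; rewrite !dotDl !dotZl !dot_proj.
Qed.

Lemma projD l u v : E l (u + v) = E l u + E l v.
Proof. by rewrite -[u]scale1r proj_lin !scale1r. Qed.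

Lemma projB l u v : E l (u - v) = E l u - E l v.
Proof. by rewrite addrC -scaleN1r proj_lin scaleN1r addrC. Qed.

Lemma projZ l a u : E l (a *: u) = a *: E l u.
Proof.
have e0 : E l 0 = 0 by have := projB l 0 0; rewrite !subrr.
by rewrite -[a *: u]addr0 proj_lin e0 addr0.
Qed.

Lemma proj_ext u v : (forall l, E l u = E l v) -> u = v.
Proof.
move=> h; apply/eqP; rewrite -subr_eq0; apply/eqP/eigenspaces_total => l w wV.
by rewrite dotC dotBl -(dot_proj u wV) -(dot_proj v wV) h subrr.
Qed.

Lemma proj_orth i j u v : i != j -> dot (E i u) (E j v) = 0.
Proof.
move=> ij; apply: eigenspace_orth ij _ _.
- by case: (spectral_projP i u).
- by case: (spectral_projP j v).
Qed.

Let scaled_orth (f : R -> R) u i j : i != j ->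
  dot (f i *: E i u) (f j *: E j u) = 0.
Proof. by move=> ij; rewrite dotZl dotZr proj_orth// !mulr0. Qed.

Let proj_orth1 u i j : i != j -> dot (E i u) (E j u) = 0.
Proof. exact: proj_orth. Qed.

Lemma bessel u (J : {fset R}) : \sum_(i <- J) `|E i u| ^+ 2 <= `|u| ^+ 2.
Proof.
have h : dot u (\sum_(i <- J) E i u) = \sum_(i <- J) `|E i u| ^+ 2.
  rewrite dotC dot_suml; apply: eq_bigr => i _.
  have [iV _] := spectral_projP i u.
  by rewrite dotC -(dot_proj _ iV) Hdot.
have := sqr_ge0 `|u - \sum_(i <- J) E i u|.
rewrite (sqr_normB Hdot) h (sqr_norm_orth_sum Hdot (proj_orth1 u)); lra.
Qed.

#[local] Existing Instance summability.totally_filter.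

Let dot_lim (x : {fset R} -> H) y v :
  x J @[J --> summability.totally] --> y ->
  dot (x J) v @[J --> summability.totally] --> dot y v.
Proof. by move=> h; exact: (cvg_dot Hdot). Qed.

Let lim_unique (f : {fset R} -> R) (a b : R) :
  f J @[J --> summability.totally] --> a ->
  f J @[J --> summability.totally] --> b -> a = b.
Proof. by move=> h1 h2; exact: (cvg_unique (@Rhausdorff R) h1 h2). Qed.

Lemma fcalc_cvg (f : R -> R) u : fcalc_dom dot A f u ->
  (fun J : {fset R} => \sum_(i <- J) f i *: E i u) @ summability.totally -->
    fcalc dot A f u.
Proof.
move=> uf; apply: (orth_sum_cvg Hdot (scaled_orth f u)).
apply: le_lt_trans uf; apply: le_esum => i _.
by rewrite normrZ exprMn real_normK ?num_real.
Qed.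

(** Paired with a vector of the [l]-eigenspace, all partial sums over index sets containing [l]
    agree, so the limit is that common value. *)
Lemma proj_fcalc (f : R -> R) u l : fcalc_dom dot A f u ->
  E l (fcalc dot A f u) = f l *: E l u.
Proof.
move=> uf.
have [lV _] := spectral_projP l u.
apply: proj_unique.
  rewrite -[_ *: _]addr0; apply: (eigenspace_subspace l).2 => //.
  by case: (eigenspace_subspace l).
move=> v vV.
apply/esym; apply: (lim_unique (dot_lim (v := v) (fcalc_cvg uf))).
apply: cvg_near_cst; exists [fset l]%fset => //= J lJ.
rewrite dot_suml (big_fsetD1 l) /=; last by rewrite -fsub1set.
rewrite big_seq big1 ?addr0// => i; rewrite !inE => /andP[il _].
rewrite dotZl (_ : dot _ _ = 0) ?mulr0//.
by apply: eigenspace_orth il _ vV; case: (spectral_projP i u).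
Qed.

(** A candidate value [y] settles membership in the domain as well: Bessel's inequality for [y]
    bounds the defining sum. *)
Lemma fcalc_unique (f : R -> R) u y : (forall l, E l y = f l *: E l u) ->
  fcalc_dom dot A f u /\ fcalc dot A f u = y.
Proof.
move=> h.
have uf : fcalc_dom dot A f u.
  apply: (@le_lt_trans _ _ (`|y| ^+ 2)%:E); last exact: ltry.
  apply: (esum_le_sums (a := fun l => f l ^+ 2 * `|E l u| ^+ 2)) => J.
  apply: le_trans (bessel y J); apply: ler_sum => i _.
  by rewrite h normrZ exprMn real_normK ?num_real.
by split => //; apply: proj_ext => l; rewrite proj_fcalc// h.
Qed.

Lemma proj_sum_cvg u :
  (fun J : {fset R} => \sum_(i <- J) E i u) @ summability.totally --> u.
Proof.
have [|ud uE] := @fcalc_unique (fun=> 1) u u; first by move=> l; rewrite scale1r.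
rewrite -{2}uE; have := fcalc_cvg ud.
by under eq_fun do under eq_bigr do rewrite scale1r.
Qed.

(** Bessel's inequality for [y] bounds every partial expansion of [x], and these converge to [x]. *)
Lemma norm_le_proj x y : (forall l, `|E l x| <= `|E l y|) -> `|x| <= `|y|.
Proof.
move=> h.
have hn : (fun J : {fset R} => `|\sum_(i <- J) E i x|) @ summability.totally
    --> `|x|.
  by apply: cvg_norm; exact: proj_sum_cvg.
apply: (closed_cvg (fun z : R => z <= `|y|) _ _ _ hn); first exact: closed_le.
apply: nearW => J.
rewrite -(ler_pXn2r (n := 2))// ?nnegrE//.
rewrite (sqr_norm_orth_sum Hdot (proj_orth1 x)).
apply: le_trans (bessel y J); apply: ler_sum => i _.
by rewrite ler_pXn2r// nnegrE.
Qed.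

Lemma proj_uop l u : dom u -> E l (A u) = l *: E l u.
Proof.
move=> du; have [[dE EE] _] := spectral_projP l u.
apply: proj_unique.
  by have [? h] := uopZ l dE; split => //; rewrite h EE.
move=> v [dv vE]; have vV : V l v by [].
by rewrite uop_sym// vE dotZl dotZr dot_proj.
Qed.

(** The weights [(1 + l) ^ (r / 2)] are thus evaluated only where the base is positive, away from
    the conventions of [powR]. *)
Let proj_neg l u : ~~ (0 <= l) -> E l u = 0.
Proof.
move=> l0; apply/eqP; apply: contraNT l0 => E0.
by apply: eigenvalue_ge0 E0; case: (spectral_projP l u).
Qed.

Let weight2 l u : (1 + l) `^ (2 / 2) *: E l u = E l u + l *: E l u.
Proof.
rewrite divff ?pnatr_eq0// -[E l u in RHS]scale1r -[l *: (_ *: _)]/(_) .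
have [l0|l0] := boolP (0 <= l); last by rewrite proj_neg// !scaler0 addr0.
by rewrite powRr1 ?addr_ge0// scale1r scalerDl scale1r.
Qed.

Lemma normHs2E u : dom u -> Hs dot A 2 u /\ normHs dot A 2 u = `|u + A u|.
Proof.
move=> du; rewrite /Hs /normHs.
have [|? ->//] := @fcalc_unique (fun l => (1 + l) `^ (2 / 2)) u (u + A u).
by move=> l; rewrite weight2 projD proj_uop.
Qed.

(** For the inclusion in [dom], the functional calculus yields a candidate [y] for [u + A u].
    Comparing partial sums gives [dot u (v + A v) = dot y v] for [v] in [dom], and self-adjointness
    then puts [u] in [dom]. *)
Lemma Hs2E : Hs dot A 2 = dom.
Proof.
apply/seteqP; split => [u uH|u /normHs2E[]//].
set f := fun l => (1 + l) `^ (2 / 2).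
pose y := fcalc dot A f u.
have yE l : E l y = E l u + l *: E l u by rewrite /y proj_fcalc// weight2.
suff [] : dom u /\ A u = y - u by [].
apply: uop_adjoint => v dv.
suff : dot u (v + A v) = dot y v.
  by rewrite dotDr dotBr (dotC _ _ y) => <-; rewrite (dotC dot v u) addrC addKr dotC.
apply: (lim_unique (dot_lim (v := v + A v) (@proj_sum_cvg u))).
have := dot_lim (v := v) (@proj_sum_cvg y).
apply: cvg_trans; apply: near_eq_cvg; apply: nearW => J.
rewrite !dot_suml; apply: eq_bigr => i _; rewrite yE dotDr dotDl.
have [[di Ei] _] := spectral_projP i u.
by rewrite -uop_sym// Ei.
Qed.

(** * Decay of the high modes *)

Section high_modes.
Variable mu : R.
Local Notation Q := (Q_eps dot A mu).

Lemma proj_Q eps l u :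
  E l (Q eps u) = (1 - \1_(`[0, mu * eps ^- 2]%classic) l) *: E l u.
Proof.
rewrite /Q_eps /P_eps projB proj_fcalc ?scalerBl ?scale1r//.
apply: (@le_lt_trans _ _ (`|u| ^+ 2)%:E); last exact: ltry.
set g := \1_ _.
apply: (esum_le_sums (a := fun l => g l ^+ 2 * `|E l u| ^+ 2)) => J.
apply: le_trans (bessel u J); apply: ler_sum => i _.
by rewrite ler_piMl ?sqr_ge0// /g indicE; case: (_ \in _); rewrite ?expr1n// expr0n.
Qed.

Lemma Q_sub eps u v : Q eps (u - v) = Q eps u - Q eps v.
Proof. by apply: proj_ext => l; rewrite projB !proj_Q projB scalerBr. Qed.

Lemma Q_le eps r u : 0 < mu -> 0 < eps -> 0 <= r -> Hs dot A r u ->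
  `|Q eps u| <= mu `^ (- (r / 2)) * eps `^ r * normHs dot A r u.
Proof.
move=> mu0 e0 r0 uH.
pose y := fcalc dot A (fun l => (1 + l) `^ (r / 2)) u.
have L0 : 0 < mu * eps ^- 2 by rewrite mulr_gt0// invr_gt0 exprn_gt0.
(* The constant is the cutoff to the power [- r / 2]: a mode that [Q] keeps lies above the cutoff,
   so this constant times its weight is at least 1. *)
have cE : mu `^ (- (r / 2)) * eps `^ r = (mu * eps ^- 2) `^ (- (r / 2)).
  rewrite powRM ?(ltW mu0)// ?invr_ge0 ?exprn_ge0 ?(ltW e0)//; congr (_ * _).
  rewrite -powR_mulrn ?(ltW e0)// -powRN -powRrM; congr (_ `^ _).
  by rewrite mulrNN mulrC divfK// pnatr_eq0.
rewrite cE; set c := _ `^ _.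
have c0 : 0 < c by exact: powR_gt0.
rewrite /normHs -/y -[c]ger0_norm ?(ltW c0)// -normrZ.
apply: norm_le_proj => l; rewrite proj_Q projZ proj_fcalc// scalerA !normrZ.
have [l0|l0] := boolP (0 <= l); last by rewrite proj_neg// normr0 !mulr0.
rewrite indicE; have [_|lL] := boolP (l \in _).
  by rewrite subrr normr0 mul0r mulr_ge0.
rewrite subr0 normr1 ler_wpM2r// !(ger0_norm (powR_ge0 _ _))//.
rewrite /c powRN ler_pdivlMl ?powR_gt0// mulr1.
apply: ge0_ler_powR; first by rewrite divr_ge0.
- by rewrite nnegrE ltW.
- by rewrite nnegrE addr_ge0.
- rewrite leNgt; apply/negP => h; move/negP: lL; apply.
  apply/mem_set; rewrite /= in_itv /= l0 /=.
  by rewrite ltW// (lt_trans _ h)// ltrDr.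
Qed.

End high_modes.
End spectral.

(** Transfers Frechet differentiability along a segment to the scalar function fed to the mean value
    theorem. *)
Lemma is_derive_affine_approx (R : realType) (f : R -> R) (t l : R) :
  (forall e, 0 < e -> exists2 d, 0 < d &
    forall s, `|s| < d -> `|f (t + s) - f t - s * l| <= e * `|s|) ->
  is_derive t 1 f l.
Proof.
move=> hf.
have cf : h^-1 *: ((f \o shift t) (h *: 1) - f t) @[h --> 0^'] --> l.
  apply/cvgrPdist_le => e e0; have [d d0 hd] := hf e e0.
  near=> h.
  have h0 : h != 0 by near: h; exact: nbhs_dnbhs_neq.
  have hd' : `|h| < d by near: h; exact: dnbhs0_lt.
  have := hd h hd'; rewrite /= -[h *: 1]/(h * 1) mulr1 [h + t]addrC => hh.
  rewrite -(ler_pM2l (x := `|h|)) ?normr_gt0// [leRHS]mulrC -normrM.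
  rewrite mulrBr -[_ *: _]/(_ * _) mulrA divff// mul1r distrC.
  by [].
split; first by apply/cvg_ex; exists l.
exact/cvg_lim.
Unshelve. all: by end_near. Qed.

Lemma le_opnorm (R : realType) (H : lmodType R) (D : set H) (n m : H -> R)
    (T : H -> H) (c : R) :
  (opnorm D n m T <= c%:E)%E ->
  (forall a h, D h -> D (a *: h) /\ n (a *: h) = `|a| * n h) ->
  (forall a h, D h -> m (T (a *: h)) = `|a| * m (T h)) ->
  (forall h, D h -> 0 <= n h /\ (n h = 0 -> h = 0)) ->
  forall h, D h -> m (T h) <= c * n h.
Proof.
move=> hc nZ mZ n0 h Dh; have [nh0 h0] := n0 _ Dh.
have [nh|nh] := eqVneq (n h) 0.
  by rewrite nh mulr0 (h0 nh) -[0](scale0r h) mZ// normr0 mul0r.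
have np : 0 < n h by rewrite lt_neqAle eq_sym nh.
have [Dh' nh'] := nZ (n h)^-1 _ Dh.
have : ((m (T ((n h)^-1 *: h)))%:E <= c%:E)%E.
  apply: le_trans hc; apply: ereal_sup_ubound; exists ((n h)^-1 *: h) => //.
  by split=> //; rewrite nh' normfV ger0_norm// mulVf.
by rewrite lee_fin mZ// normfV ger0_norm// mulrC ler_pdivrMr.
Qed.

(** * The graph norm of [H^2] *)

Section persistence.
Context (R : realType) (H : completeNormedModType R) (dot : {dot H for idfun})
  (A : unbounded_op H).
Hypotheses (Hdot : induces_norm dot) (HAsa : self_adjoint dot A)
  (HAnn : nonnegative_op dot A) (HAcr : compact_resolvent A).
Implicit Types (u v w h : H).

Local Notation dom := (uop_dom A).
Local Notation N := (normHs dot A 2).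

Let Hs2 : Hs dot A 2 = dom. Proof. exact: Hs2E. Qed.

Let NE u : dom u -> N u = `|u + A u|.
Proof. by move=> du; have [] := normHs2E Hdot HAsa HAnn HAcr du. Qed.

Let N_ge0 u : 0 <= N u. Proof. exact: normr_ge0. Qed.

Lemma normHs2Z a u : dom u -> N (a *: u) = `|a| * N u.
Proof.
move=> du; have [dau e] := uopZ HAsa a du.
by rewrite !NE// e -scalerDr normrZ.
Qed.

Lemma normHs2D u v : dom u -> dom v -> N (u + v) <= N u + N v.
Proof.
move=> du dv; have [duv e] := uopD HAsa du dv.
by rewrite !NE// e addrACA ler_normD.
Qed.

(** Pair [u + A u] with [u]: nonnegativity bounds the product below by [|u| ^ 2], Cauchy-Schwarz
    above by [N u |u|]. *)
Lemma norm_le_normHs2 u : dom u -> `|u| <= N u.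
Proof.
move=> du; have [->|u0] := eqVneq u 0; first by rewrite normr0 normr_ge0.
have up : 0 < `|u| by rewrite normr_gt0.
rewrite NE// -(ler_pM2r up) -expr2 -Hdot; apply: le_trans (dot_le Hdot _ _).
by rewrite dotDl lerDl HAnn.
Qed.

Let N0 u : dom u -> N u = 0 -> u = 0.
Proof.
by move=> du e; apply/eqP; rewrite -normr_le0 -e norm_le_normHs2.
Qed.

Let dom_scale a u : dom u -> dom (a *: u).
Proof. by move=> du; have [] := uopZ HAsa a du. Qed.
Let domD u v : dom u -> dom v -> dom (u + v).
Proof. by move=> du dv; have [] := uopD HAsa du dv. Qed.
Let domB u v : dom u -> dom v -> dom (u - v).
Proof. by move=> du dv; have [] := uopB HAsa du dv. Qed.

Lemma norm_LH2H_le (T T' : {linear H -> H}) (c : R) :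
  (norm_LH2H dot A (fun h => T h - T' h)%R <= c%:E)%E ->
  forall h, dom h -> `|T h - T' h| <= c * N h.
Proof.
rewrite /norm_LH2H Hs2 => hc.
apply: (le_opnorm hc (m := fun u => `|u|) (T := fun h => T h - T' h)).
- by move=> a h dh; split; [exact: dom_scale|exact: normHs2Z].
- by move=> a h _ /=; rewrite linearZZ [T' _]linearZZ -scalerBr normrZ.
- by move=> h dh; split; [exact: normr_ge0|exact: N0].
Qed.

(** * Continuation of the equilibrium *)

Section equilibrium.
Context (mu : R) (F : H -> H) (U : set H) (DF : H -> {linear H -> H})
  (ustar : H).
Hypotheses (Hmu : 0 < mu) (HUopen : openHs dot A 2 U) (HUstar : U ustar)
  (HF : regular_on dot A U F DF) (Heq : equilibrium A F ustar)
  (Hnd : nondegenerate_at dot A DF ustar).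

Let dstar : dom ustar. Proof. by case: Heq. Qed.

(* The mean value inequality, applied to [F - DF ustar] paired with its own
   increment. *)
Lemma remainder_lipschitz (e : R) : 0 < e -> exists2 d, 0 < d &
  forall v w, dom v -> dom w -> N (v - ustar) < d -> N (w - ustar) < d ->
    `|F v - F w - DF ustar (v - w)| <= e * N (v - w).
Proof.
move=> e0; case: HF => Ffr Fcont _.
have [_ /(_ _ HUstar)[_ [d1 d10 hd1]]] := HUopen.
have [d2 d20 hd2] := Fcont _ HUstar e e0.
(* [d1] keeps the segment from [w] to [v] inside [U]; [d2] keeps the derivative within [e] of
   [DF ustar] along it. *)
exists (Num.min d1 d2); first by rewrite lt_min d10.
move=> v w dv dw; rewrite !lt_min => /andP[v1 v2] /andP[w1 w2].
pose k := v - w; have dk : dom k by exact: domB.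
pose p (t : R) := w + t *: k.
have dp t : dom (p t) by apply: domD => //; exact: dom_scale.
have pB (t d : R) : 0 <= t <= 1 -> N (v - ustar) < d -> N (w - ustar) < d ->
    N (p t - ustar) < d.
  move=> /andP[t0 t1] hv hw.
  have -> : p t - ustar = t *: (v - ustar) + (1 - t) *: (w - ustar).
    rewrite scalerBl scale1r addrCA -scalerBr opprB addrA subrK.
    by rewrite /p addrAC.
  have [dvu dwu] : dom (v - ustar) /\ dom (w - ustar) by split; exact: domB.
  apply: le_lt_trans (normHs2D (dom_scale _ dvu) (dom_scale _ dwu)) _.
  rewrite !normHs2Z// !ger0_norm ?subr_ge0//.
  have [->|t00] := eqVneq t 0; first by rewrite mul0r add0r subr0 mul1r.
  have tp : 0 < t by rewrite lt_neqAle eq_sym t00.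
  have a1 : t * N (v - ustar) < t * d by rewrite ltr_pM2l.
  have a2 : (1 - t) * N (w - ustar) <= (1 - t) * d.
    by rewrite ler_wpM2l ?subr_ge0// ltW.
  lra.
have pU (t : R) : 0 <= t <= 1 -> U (p t).
  by move=> t01; apply: hd1; split; [rewrite Hs2|exact: pB].
set z := F v - F w - DF ustar k.
pose f t := dot (F (p t) - t *: DF ustar k) z.
pose df t := dot (DF (p t) k - DF ustar k) z.
have fder (t : R) : 0 <= t <= 1 -> is_derive t 1 f (df t).
  move=> t01; apply: is_derive_affine_approx => eta eta0.
  have [_ fr] := Ffr _ (pU _ t01).
  (* The tolerance must absorb the length of [k] and the pairing with [z]; adding 1 avoids dividing
     by zero. *)
  have c0 : 0 < (N k + 1) * (`|z| + 1).
    by rewrite mulr_gt0// ltr_wpDl// normr_ge0.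
  have [d d0 hd] := fr _ (divr_gt0 eta0 c0).
  have Nk0 : 0 < N k + 1 by rewrite ltr_wpDl// normr_ge0.
  exists (d / (N k + 1)); first by rewrite divr_gt0.
  move=> s; rewrite ltr_pdivlMr// => hs.
  have hsk : N (s *: k) <= `|s| * (N k + 1).
    by rewrite normHs2Z// ler_wpM2l// lerDl.
  have := hd (s *: k); rewrite Hs2 => /(_ (dom_scale s dk) (le_lt_trans hsk hs)).
  set q := F _ - F _ - _ => hq.
  have -> : f (t + s) - f t - s * df t = dot q z.
    rewrite /f /df -dotBl -dotZl -dotBl; congr (dot _ z).
    have -> : p (t + s) = p t + s *: k by rewrite /p scalerDl addrA.
    rewrite /q [DF (p t) (_ *: _)]linearZ /= [s *: (DF _ _ - _)]scalerBr.
    rewrite [(t + s) *: _]scalerDl.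
    by rewrite !opprB opprD !addrA (addrAC _ _ (t *: _)) subrK
      (addrAC _ _ (s *: DF ustar k)) subrK.
  apply: le_trans (normr_dot_le Hdot _ _) _.
  apply: le_trans (ler_pM _ _ hq (_ : `|z| <= `|z| + 1)) _ => //.
    by rewrite lerDl.
  have zp : 0 < `|z| + 1 by rewrite ltr_wpDl// normr_ge0.
  have -> : eta * `|s| =
      eta / ((N k + 1) * (`|z| + 1)) * (`|s| * (N k + 1)) * (`|z| + 1).
    by field; rewrite !gt_eqF.
  by rewrite ler_pM2r// ler_pM2l ?divr_gt0.
have fdiff (t : R) : t \in `[0, 1] -> is_derive t 1 f (df t).
  by rewrite in_itv; exact: fder.
have fc : {within `[0, 1], continuous f}.
  apply: derivable_within_continuous => t t01.
  by case: (fdiff _ t01).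
have fd (t : R) : t \in `]0, 1[ -> is_derive t 1 f (df t).
  by move=> /subset_itv_oo_cc; exact: fdiff.
have [c c01] := MVT (@ltr01 R) fd fc.
rewrite subr0 mulr1.
have -> : f 1 - f 0 = `|z| ^+ 2.
  have p1 : p 1 = v by rewrite /p scale1r addrC subrK.
  have p0 : p 0 = w by rewrite /p scale0r addr0.
  by rewrite /f p1 p0 -dotBl scale1r scale0r subr0 -(Hdot z) addrAC.
move=> zE.
have [->|z0] := eqVneq z 0; first by rewrite normr0 mulr_ge0 ?(ltW e0).
have zp : 0 < `|z| by rewrite normr_gt0.
rewrite -(ler_pM2r zp) -expr2 zE; apply: le_trans (dot_le Hdot _ _) _.
rewrite ler_pM2r//.
have c01' : 0 <= c <= 1 by move: c01; rewrite in_itv /= => /andP[/ltW-> /ltW->].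
by apply: norm_LH2H_le => //; apply: hd2; [exact: pU|exact: pB].
Qed.

Local Notation Q := (Q_eps dot A mu).
Local Notation B := (DF ustar).

Let Q_le2 eps h : 0 < eps -> dom h ->
  `|eps^-1 *: Q eps h| <= eps / mu * N h.
Proof.
move=> e0 dh; have hh : Hs dot A 2 h by rewrite Hs2.
have := Q_le Hdot HAsa HAnn HAcr Hmu e0 (ler0n R 2) hh.
rewrite divff ?pnatr_eq0// powR_inv1 ?(ltW Hmu)// powR_mulrn ?(ltW e0)// => hq.
rewrite normrZ normfV gtr0_norm// ler_pdivrMl//.
apply: le_trans hq _; rewrite le_eqVlt; apply/orP; left; apply/eqP.
by field; rewrite gt_eqF.
Qed.

Lemma solution_bound : exists S : {linear H -> H}, exists2 s : R, 0 < s &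
  [/\ forall f, dom (S f) /\ A (S f) - B (S f) = f,
      forall h, dom h -> S (A h - B h) = h &
      forall f, N (S f) <= s * `|f|].
Proof.
case: Hnd => _ _ [S [S1 S2 S3]]; exists S.
have Sd f : dom (S f) by rewrite -Hs2; case: (S1 f).
pose m := norm_LHH2 dot A S.
have Sp : (m <= (fine m)%:E)%E.
  rewrite fineK// ge0_fin_numE//; apply: ereal_sup_ubound; exists 0.
    by split=> //; rewrite normr0.
  by rewrite linear0 -(scale0r ustar) normHs2Z// normr0 mul0r.
have SN f : N (S f) <= fine m * `|f|.
  apply: (le_opnorm Sp (n := fun u => `|u|) (m := N) (T := S)) => //.
  - by move=> a h _; rewrite normrZ.
  - by move=> a h _; rewrite linearZZ normHs2Z.
  - by move=> h _; split => // /normr0_eq0.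
(* Enlarged so as to be positive, since later constants divide by [s]. *)
exists (`|fine m| + 1); first by rewrite ltr_wpDl.
split=> [f|h dh|f].
- by split=> //; case: (S1 f).
- by apply: S2; rewrite Hs2.
- apply: le_trans (SN f) _; rewrite ler_wpM2r//.
  by rewrite (le_trans (ler_norm _))// lerDl.
Qed.

(* Writing [L = A - DF ustar], a vector [v] is an equilibrium of [A_eps] iff
   [f = L (v - ustar)] is a fixed point of a map which is contracting on a
   ball of [H], because [eps^-1 *: Q_eps] is [O(eps)] from [H^2] to [H]. *)
Lemma local_continuation : exists (eps0 d c : R),
  [/\ 0 < eps0 <= 1, 0 < d, 0 < c &
  forall eps, 0 < eps <= eps0 -> exists u,
    [/\ ballHs dot A 2 ustar d u, equilibrium (A_eps dot A mu eps) F u,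
       N (u - ustar) <= c * `|eps^-1 *: Q eps ustar| &
       forall v, ballHs dot A 2 ustar d v ->
         equilibrium (A_eps dot A mu eps) F v -> v = u]].
Proof.
have [S [s s0 [S1 S2 S3]]] := solution_bound.
(* The remainder of [F] and the term [eps^-1 Q] each get Lipschitz constant [1 / (4 s)]; composed
   with [S], of norm at most [s], their sum contracts by [1 / 2]. *)
have q0 : 0 < (4 * s)^-1 by rewrite invr_gt0 mulr_gt0.
have [d d0 hd] := remainder_lipschitz q0.
(* [S] sends the [rho]-ball of [H] into the [d / 2]-ball of [H^2]. *)
pose rho := d / (2 * s).
have rho0 : 0 < rho by rewrite divr_gt0// mulr_gt0.
(* [e1] yields [eps / mu <= 1 / (4 s)]; [e2] yields [|Phi 0| <= rho / 2], so that the contraction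
   preserves the [rho]-ball. *)
pose e1 := mu / (4 * s); pose e2 := mu * rho / (2 * (N ustar + 1)).
have Ns0 : 0 < N ustar + 1 by rewrite ltr_wpDl// normr_ge0.
have e10 : 0 < e1 by rewrite divr_gt0// mulr_gt0.
have e20 : 0 < e2 by apply: divr_gt0; apply: mulr_gt0.
exists (Num.min 1 (Num.min e1 e2)), d, (2 * s); split => //.
- by rewrite !lt_min ltr01 e10 e20 /= ge_min lexx.
- by rewrite mulr_gt0.
move=> eps /andP[ep]; rewrite !le_min => /and3P[_ ee1 ee2].
have epsmu : eps / mu <= (4 * s)^-1 by rewrite ler_pdivrMr// mulrC.
(* The perturbed equation reads [A v - B v = Psi v]. Subtracting the same expression at [ustar],
   where [A ustar = F ustar], gives the fixed point equation for [Phi]. *)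
pose Psi v := F v - B v - eps^-1 *: Q eps v.
have Psi_lip v w : dom v -> dom w -> N (v - ustar) < d -> N (w - ustar) < d ->
    `|Psi v - Psi w| <= (2 * s)^-1 * N (v - w).
  move=> dv dw hv hw.
  have -> : Psi v - Psi w = (F v - F w - B (v - w)) - eps^-1 *: Q eps (v - w).
    rewrite /Psi (Q_sub Hdot HAsa HAcr) [B (_ - _)]linearB /=.
    move: (Q eps v) (Q eps w) => qv qw.
    apply: (dot_inj Hdot) => x; rewrite !(dotBl, dotZl); ring.
  apply: le_trans (ler_normB _ _) _.
  have dvw : dom (v - w) by exact: domB.
  have a1 := hd _ _ dv dw hv hw.
  have a2 := le_trans (Q_le2 ep dvw) (ler_wpM2r (N_ge0 _) epsmu).
  apply: le_trans (lerD a1 a2) _.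
  rewrite -mulrDl le_eqVlt; apply/orP; left; apply/eqP; congr (_ * _).
  by field; rewrite gt_eqF.
pose Phi f := Psi (ustar + S f) - (F ustar - B ustar).
have addK u h : u + h - u = h :> H by rewrite addrC addKr.
have Sd f : dom (S f) by case: (S1 f).
have near f : `|f| <= rho -> N (ustar + S f - ustar) < d.
  move=> hf; rewrite addK; apply: le_lt_trans (S3 f) _.
  apply: (@le_lt_trans _ _ (s * rho)); first by rewrite ler_pM2l.
  rewrite /rho (_ : s * _ = d / 2); last by field; rewrite gt_eqF.
  by rewrite ltr_pdivrMr// ltr_pMr// ltr1n.
have dS f : dom (ustar + S f) by exact: domD.
have Phi_lip f g : `|f| <= rho -> `|g| <= rho ->
    `|Phi f - Phi g| <= 2^-1 * `|f - g|.
  move=> hf hg; rewrite /Phi; move: (F ustar - B ustar) => c.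
  rewrite opprB addrA subrK.
  apply: le_trans (Psi_lip _ _ (dS f) (dS g) (near _ hf) (near _ hg)) _.
  rewrite opprD addrACA subrr add0r -linearB.
  apply: (@le_trans _ _ ((2 * s)^-1 * (s * `|f - g|))).
    by rewrite ler_wpM2l// invr_ge0 mulr_ge0// ltW.
  rewrite le_eqVlt; apply/orP; left; apply/eqP.
  by field; rewrite gt_eqF.
have Phi0 : Phi 0 = - (eps^-1 *: Q eps ustar).
  by rewrite /Phi /Psi linear0 addr0 addrAC subrr add0r.
have Phi0_le : `|Phi 0| <= rho / 2.
  rewrite Phi0 normrN; apply: le_trans (Q_le2 ep dstar) _.
  apply: (@le_trans _ _ (eps / mu * (N ustar + 1))).
    by rewrite ler_wpM2l ?lerDl// divr_ge0// ltW.
  have : eps * (2 * (N ustar + 1)) <= mu * rho.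
    by rewrite -ler_pdivlMr// mulr_gt0.
  rewrite -ler_pdivrMl//.
  set x := mu^-1 * _ => hx.
  have -> : eps / mu * (N ustar + 1) = x / 2.
    by rewrite /x; field; rewrite gt_eqF.
  by rewrite ler_pM2r.
pose D := [set f : H | `|f| <= rho].
have D0 : D 0 by rewrite /D /= normr0 ltW.
have Phi_le f : D f -> `|Phi f| <= 2^-1 * `|f| + `|Phi 0|.
  move=> Df; rewrite -{1}(subrK (Phi 0) (Phi f)).
  apply: le_trans (ler_normD _ _) _.
  by rewrite lerD2r -{2}[f]subr0; exact: Phi_lip.
have PhiD : set_fun D D Phi.
  move=> f Df; rewrite /D /=; apply: le_trans (Phi_le _ Df) _.
  have : `|f| <= rho by []. lra.
have [f Df fE] : exists2 f, D f & f = Phi f.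
  have := @banach_fixed_point R H D (mkfun PhiD).
  apply.
  - exists (2^-1)%:nng; split; first by rewrite /= invf_lt1// ltr1n.
    by move=> [f g] /= [hf hg]; exact: Phi_lip.
  - apply: (@closed_comp _ _ (fun f : H => `|f|) [set x : R | x <= rho]).
      by move=> x _; exact: norm_continuous.
    exact: closed_le.
  - by exists 0.
have [_ LSf] := S1 f.
set u := ustar + S f.
have uE : A u + eps^-1 *: Q eps u = F u.
  have [_ ->] := uopD HAsa dstar (Sd f).
  have -> : A (S f) = f + B (S f) by apply/eqP; rewrite -subr_eq LSf.
  have BE : B (S f) = B u - B ustar by rewrite /u linearD [RHS]addrC addKr.
  case: Heq => _ ->; rewrite BE [X in X + (B u - _)]fE /Phi /Psi -/u.
  move: (Q eps u) => qu.
  apply: (dot_inj Hdot) => x; rewrite !(dotBl, dotDl); ring.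
exists u; split.
- by split; [rewrite Hs2; exact: dS|exact: near].
- by split => //; exact: dS.
(* At the fixed point [|f| <= |f| / 2 + |Phi 0|], so [|f| <= 2 |Phi 0|]; hence the constant
   [2 s]. *)
- rewrite addK; apply: le_trans (S3 f) _.
  rewrite -mulrA mulrCA ler_pM2l//.
  have := Phi_le _ Df; rewrite -fE Phi0 normrN; lra.
- move=> v [dv hv] [_ /= vE]; rewrite Hs2 in dv.
  have [dvw AvE] := uopB HAsa dv (dS f).
  have LE : A (v - u) - B (v - u) = Psi v - Psi u.
    have Av : A v = F v - eps^-1 *: Q eps v by rewrite -vE addrK.
    have Au : A u = F u - eps^-1 *: Q eps u by rewrite -uE addrK.
    rewrite AvE Av Au [B (_ - _)]linearB /= /Psi.
    move: (Q eps v) (Q eps u) => qv qu.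
    apply: (dot_inj Hdot) => x; rewrite !(dotBl, dotDl); ring.
  (* Apply [S] to the difference of the two equations; [Psi_lip] asks only that [v] and [u] lie in
     the [H^2] ball. *)
  have : N (v - u) <= 2^-1 * N (v - u).
    rewrite -{1}(S2 _ dvw) LE; apply: le_trans (S3 _) _.
    rewrite -ler_pdivlMl// mulrA -invfM (mulrC s).
    by apply: Psi_lip => //; [exact: dS|exact: near].
  have Nge := N_ge0 (v - u).
  move=> h; apply/eqP; rewrite -subr_eq0; apply/eqP; apply: N0 => //.
  by lra.
Qed.

(** The threshold and the ball come before [r]: only the residual estimate, hence [C], depends on
    the smoothness of [ustar]. *)
Lemma persists_Hs : exists (eps0 d : R), [/\ 0 < eps0 <= 1, 0 < d &
  forall r, 0 <= r -> Hs dot A r ustar -> exists2 C, 0 < C &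
    persists dot A mu F ustar eps0 (ballHs dot A 2 ustar d)
      (fun eps => C * eps `^ (r - 1) * normHs dot A r ustar)].
Proof.
have [eps0 [d [c [e01 d0 c0 hu]]]] := local_continuation.
exists eps0, d; split => // r r0 ur; exists (c * mu `^ (- (r / 2))).
  by rewrite mulr_gt0// powR_gt0.
have /boolp.choice[ueps uP] : forall eps, exists u, 0 < eps <= eps0 ->
    [/\ ballHs dot A 2 ustar d u, equilibrium (A_eps dot A mu eps) F u,
       N (u - ustar) <= c * `|eps^-1 *: Q eps ustar| &
       forall v, ballHs dot A 2 ustar d v ->
         equilibrium (A_eps dot A mu eps) F v -> v = u].
  move=> eps; have [/hu[u uP]|_] := boolP (0 < eps <= eps0); first by exists u.
  by exists 0.
exists ueps => eps he; have [u1 u2 u3 u4] := uP _ he; split => //.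
have [ep _] := andP he.
apply: le_trans u3 _; rewrite -!mulrA ler_pM2l// normrZ normfV gtr0_norm//.
rewrite ler_pdivrMl//; apply: le_trans (Q_le Hdot HAsa HAnn HAcr Hmu ep r0 ur) _.
have -> : eps `^ r = eps * eps `^ (r - 1).
  rewrite -{1}(subrK 1 r) powRD; last by rewrite (gt_eqF ep) implybT.
  by rewrite powRr1 ?(ltW ep)// mulrC.
rewrite le_eqVlt; apply/orP; left; apply/eqP; ring.
Qed.

End equilibrium.
End persistence.

Unset Implicit Arguments.

Theorem theorem6p9 (R : realType) (H : completeNormedModType R)
    (dot : {dot H for idfun}) (A : unbounded_op H) (mu : R)
    (F : H -> H) (U : set H) (DF : H -> {linear H -> H}) (ustar : H)
    (Hdot : induces_norm dot)
    (Hinf : infinite_dimensional H)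
    (HAsa : self_adjoint dot A)
    (HAnn : nonnegative_op dot A)
    (HAcr : compact_resolvent A)
    (Hmu : 0 < mu)
    (HUopen : openHs dot A 2 U)
    (HUbnd : boundedHs dot A 2 U)
    (HUstar : U ustar)
    (HF : regular_on dot A U F DF)
    (Heq : equilibrium A F ustar)
    (Hnd : nondegenerate_at dot A DF ustar) :
  (forall r : R, 2 <= r -> Hs dot A r ustar ->
    exists (eps0 : R) (Ustar : set H) (C : R),
      [/\ 0 < eps0 <= 1, nbhdHs dot A 2 ustar Ustar, 0 < C &
          persists dot A mu F ustar eps0 Ustar
            (fun eps => C * eps `^ (r - 1) * normHs dot A r ustar)]) /\
  (exists (eps0 : R) (Ustar : set H) (C : R),
      [/\ 0 < eps0 <= 1, nbhdHs dot A 2 ustar Ustar, 0 < C &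
          persists dot A mu F ustar eps0 Ustar (fun eps => C * eps)]).

Proof.
have [eps0 [d [e01 d0 hp]]] :=
  persists_Hs Hdot HAsa HAnn HAcr Hmu HUopen HUstar HF Heq Hnd.
have nbhd : nbhdHs dot A 2 ustar (ballHs dot A 2 ustar d).
  by split; [move=> v []|exists d].
split=> [r r2 ur|].
  have [C C0 hC] := hp r (le_trans (ler0n _ 2) r2) ur.
  by exists eps0, (ballHs dot A 2 ustar d), C.
have u2 : Hs dot A 2 ustar by exact: HUopen.1.
have [C C0 [ueps hC]] := hp 2 (ler0n _ 2) u2.
have N0 : 0 <= normHs dot A 2 ustar by exact: normr_ge0.
(* The case [r = 2], with the norm of [ustar] absorbed in the constant; adding 1 keeps it positive
   when [ustar = 0]. *)
exists eps0, (ballHs dot A 2 ustar d), (C * (normHs dot A 2 ustar + 1)).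
split => //; first by rewrite mulr_gt0// ltr_wpDl.
exists ueps => eps he; have [h1 h2 h3 h4] := hC _ he; split => //.
have [ep _] := andP he.
apply: le_trans h3 _.
have -> : 2 - 1 = 1 :> R by ring.
by rewrite powRr1 ?(ltW ep)// mulrAC ler_pM2r// ler_pM2l// lerDl.
Qed.
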